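(* Let $y:\mathbb{R}^n\to\mathbb{R}^m$ have vector relative degree $r=(r_1,\dots,r_m)$ on an open set $\mathcal{E}\supset\mathcal{S}$ for the system $\dot x=f(x)+g(x)u$, and consider the output constraints $\underline{y}_i\le y_i(x)\le\overline{y}_i$, $i\in\{1,\dots,m\}$, the associated exponential control barrier functions $\underline{h}_i(x)=y_i(x)-\underline{y}_i$ and $\overline{h}_i(x)=\overline{y}_i-y_i(x)$ with gains $\alpha_i=(\alpha^i_1,\dots,\alpha^i_{r_i})$, and the resulting safety filter $$\min_{u\in\mathbb{R}^m}\ \tfrac12(u-k_{\rm d}(x))^\top G(x)(u-k_{\rm d}(x))$$ subject to, for all $i\in\{1,\dots,m\}$, $$L_f^{r_i}\underline{h}_i(x)+L_gL_f^{r_i-1}\underline{h}_i(x)\,u\ \ge\ -\alpha_i^\top\underline{H}_i(x),\qquad L_f^{r_i}\overline{h}_i(x)+L_gL_f^{r_i-1}\overline{h}_i(x)\,u\ \ge\ -\alpha_i^\top\overline{H}_i(x).$$ Provided that $\alpha^i_1>0$ and $\overline{y}_i>\underline{y}_i$ for all $i\in\{1,\dots,m\}$, the $2m$ constraints of this safety filter are compatible for all $x\in\mathcal{E}\supset\mathcal{S}$, i.e. for every $x\in\mathcal{E}$ there exists a single $u\in\mathbb{R}^m$ satisfying all of them simultaneously.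
   Context: System: $\dot x=f(x)+g(x)u$ with $x\in\mathbb{R}^n$, $u\in\mathbb{R}^m$, where $f:\mathbb{R}^n\to\mathbb{R}^n$ and $g:\mathbb{R}^n\to\mathbb{R}^{n\times m}$ are smooth (continuously differentiable as many times as necessary). The output $y=(y_1,\dots,y_m):\mathbb{R}^n\to\mathbb{R}^m$ is smooth. Lie derivatives: $L_fh(x)=\frac{\partial h}{\partial x}(x)f(x)$, $L_f^0h=h$, $L_f^ih=L_f(L_f^{i-1}h)$, and $L_gh(x)=\frac{\partial h}{\partial x}(x)g(x)\in\mathbb{R}^{1\times m}$. In the safety filter, $k_{\rm d}:\mathbb{R}^n\to\mathbb{R}^m$ is a desired controller and $G:\mathbb{R}^n\to\mathbb{R}^{m\times m}$ is positive definite. Vector relative degree: $y$ has vector relative degree $r=(r_1,\dots,r_m)$ (positive integers) at $x$ if for all $i$, $L_gL_f^jy_i(x)=0$ for all $j\in\{0,\dots,r_i-2\}$, and the decoupling matrix $B(x)\in\mathbb{R}^{m\times m}$, whose $i$-th row is $b_i(x)^\top:=L_gL_f^{r_i-1}y_i(x)$, is invertible. It has vector relative degree $r$ on a set if this holds at each point of the set (with the same $r$). Bounds and gains: $\underline{y}_i,\overline{y}_i\in\mathbb{R}$. For each $i$, $\alpha_i=(\alpha_1^i,\dots,\alpha_{r_i}^i)\in\mathbb{R}^{r_i}$ is such that $s^{r_i}+\alpha^i_{r_i}s^{r_i-1}+\dots+\alpha^i_2s+\alpha^i_1=\prod_{j=1}^{r_i}(s-\nu^i_j)$ with all $\nu^i_j$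 real and negative. Barrier functions: $\underline{H}_i(x)=(\underline{h}_i(x),L_f\underline{h}_i(x),\dots,L_f^{r_i-1}\underline{h}_i(x))^\top$ and $\overline{H}_i(x)=(\overline{h}_i(x),L_f\overline{h}_i(x),\dots,L_f^{r_i-1}\overline{h}_i(x))^\top$. Safe set: for $h\in\{\underline{h}_i,\overline{h}_i\}$ define recursively $\psi_0(x)=h(x)$ and $\psi_j(x)=\frac{d}{dt}\psi_{j-1}(x)-\nu^i_j\psi_{j-1}(x)$ for $j\in\{1,\dots,r_i\}$, where $\frac{d}{dt}$ is the time derivative along trajectories of the system (under the relative degree condition it is independent of the input for $j\le r_i-1$; for $j=r_i$ it involves the input, which is the applied feedback law when the loop is closed). Set $\underline{\mathcal{S}}_i=\bigcap_{j=0}^{r_i}\{x\in\mathbb{R}^n:\psi_j(x)\ge0\}$ for $h=\underline{h}_i$, and $\overline{\mathcal{S}}_i$ likewise for $h=\overline{h}_i$. Then $\mathcal{S}:=\big(\bigcap_{i=1}^m\underline{\mathcal{S}}_i\big)\cap\big(\bigcap_{i=1}^m\overline{\mathcal{S}}_i\big)$. *)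

(* Defs.v *)
From HB Require Import structures.
From mathcomp Require Import all_boot all_order all_algebra.
From mathcomp Require Import all_classical all_reals all_analysis.

Set Implicit Arguments.
Unset Strict Implicit.
Unset Printing Implicit Defensive.

Import Order.TTheory GRing.Theory Num.Theory.
Import numFieldNormedType.Exports.
Local Open Scope classical_set_scope.
Local Open Scope ring_scope.

(* Points of R^n are column vectors. *)

(* h is k times continuously differentiable on R^n; V may be R, 'cV_p or
   'M_(p, q). *)
Fixpoint Ck (R : realType) (n : nat) (V : normedModType R) (k : nat)
    (h : 'cV[R]_n -> V) : Prop :=
  match k with
  | 0%N => continuous h
  | k'.+1 => (forall x, differentiable h x) /\
             (forall j : 'I_n, Ck k' (fun x => 'D_(delta_mx j 0) h x))
  end.

Definition gradient (R : realType) (n : nat) (h : 'cV[R]_n -> R)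
    (x : 'cV[R]_n) : 'rV[R]_n :=
  \row_(j < n) 'D_(delta_mx j 0) h x.

Definition lie (R : realType) (n : nat) (f : 'cV[R]_n -> 'cV[R]_n)
    (h : 'cV[R]_n -> R) (x : 'cV[R]_n) : R :=
  (gradient h x *m f x) 0 0.

Definition lie_iter (R : realType) (n : nat) (f : 'cV[R]_n -> 'cV[R]_n)
    (i : nat) (h : 'cV[R]_n -> R) : 'cV[R]_n -> R :=
  iter i (lie f) h.

Definition lie_mx (R : realType) (n m : nat) (g : 'cV[R]_n -> 'M[R]_(n, m))
    (h : 'cV[R]_n -> R) (x : 'cV[R]_n) : 'rV[R]_m :=
  gradient h x *m g x.

Definition output (R : realType) (n m : nat) (y : 'cV[R]_n -> 'cV[R]_m)
    (i : 'I_m) (x : 'cV[R]_n) : R := y x i 0.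

Definition decoupling (R : realType) (n m : nat) (f : 'cV[R]_n -> 'cV[R]_n)
    (g : 'cV[R]_n -> 'M[R]_(n, m)) (y : 'cV[R]_n -> 'cV[R]_m)
    (r : 'I_m -> nat) (x : 'cV[R]_n) : 'M[R]_m :=
  \matrix_(i < m) lie_mx g (lie_iter f (r i).-1 (output y i)) x.

Definition vector_relative_degree_at (R : realType) (n m : nat)
    (f : 'cV[R]_n -> 'cV[R]_n) (g : 'cV[R]_n -> 'M[R]_(n, m))
    (y : 'cV[R]_n -> 'cV[R]_m) (r : 'I_m -> nat) (x : 'cV[R]_n) : Prop :=
  [/\ forall i, (0 < r i)%N,
      forall i j, (j.+2 <= r i)%N ->
        lie_mx g (lie_iter f j (output y i)) x = 0
    & decoupling f g y r x \in unitmx].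

Definition vector_relative_degree_on (R : realType) (n m : nat)
    (f : 'cV[R]_n -> 'cV[R]_n) (g : 'cV[R]_n -> 'M[R]_(n, m))
    (y : 'cV[R]_n -> 'cV[R]_m) (r : 'I_m -> nat) (D : set 'cV[R]_n) : Prop :=
  forall x, D x -> vector_relative_degree_at f g y r x.

Definition lower_barrier (R : realType) (n m : nat)
    (y : 'cV[R]_n -> 'cV[R]_m) (ylow : 'I_m -> R) (i : 'I_m)
    (x : 'cV[R]_n) : R := output y i x - ylow i.

Definition upper_barrier (R : realType) (n m : nat)
    (y : 'cV[R]_n -> 'cV[R]_m) (yup : 'I_m -> R) (i : 'I_m)
    (x : 'cV[R]_n) : R := yup i - output y i x.

Definition barrier_vector (R : realType) (n : nat)
    (f : 'cV[R]_n -> 'cV[R]_n) (k : nat) (h : 'cV[R]_n -> R)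
    (x : 'cV[R]_n) : 'cV[R]_k :=
  \col_(j < k) lie_iter f j h x.

(* Gains are numbered from 1 in the mathematics and from 0 here: the entry of
   index j of a is the coefficient of s^j, and nu lists the roots. *)
Definition gains_with_roots (R : realType) (k : nat) (a : 'cV[R]_k)
    (nu : k.-tuple R) : Prop :=
  'X^k + \sum_(j < k) a j 0 *: 'X^j = \prod_(c <- nu) ('X - c%:P) /\
  (forall c, c \in nu -> c < 0).

Definition closed_loop (R : realType) (n m : nat)
    (f : 'cV[R]_n -> 'cV[R]_n) (g : 'cV[R]_n -> 'M[R]_(n, m))
    (k : 'cV[R]_n -> 'cV[R]_m) (x : 'cV[R]_n) : 'cV[R]_n :=
  f x + g x *m k x.

(* The time derivative along the trajectories of x' = F x is the Lie derivative
   along F.  The root used in the step to j+1 is numbered j+1 in the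
   mathematics, hence has index j in nu. *)
Fixpoint psi (R : realType) (n : nat) (F : 'cV[R]_n -> 'cV[R]_n)
    (nu : seq R) (h : 'cV[R]_n -> R) (j : nat) : 'cV[R]_n -> R :=
  match j with
  | 0%N => h
  | j'.+1 => fun x => lie F (psi F nu h j') x - nu`_j' * psi F nu h j' x
  end.

Definition barrier_safe_set (R : realType) (n : nat)
    (F : 'cV[R]_n -> 'cV[R]_n) (k : nat) (nu : k.-tuple R)
    (h : 'cV[R]_n -> R) : set 'cV[R]_n :=
  \bigcap_(j in [set j | (j <= k)%N]) [set x | 0 <= psi F nu h j x].

Definition safe_set (R : realType) (n m : nat)
    (f : 'cV[R]_n -> 'cV[R]_n) (g : 'cV[R]_n -> 'M[R]_(n, m))
    (k : 'cV[R]_n -> 'cV[R]_m) (y : 'cV[R]_n -> 'cV[R]_m) (r : 'I_m -> nat)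
    (nu : forall i, (r i).-tuple R) (ylow yup : 'I_m -> R) : set 'cV[R]_n :=
  (\bigcap_(i in [set: 'I_m])
     barrier_safe_set (closed_loop f g k) (nu i) (lower_barrier y ylow i)) `&`
  (\bigcap_(i in [set: 'I_m])
     barrier_safe_set (closed_loop f g k) (nu i) (upper_barrier y yup i)).

(* No symmetry is imposed. *)
Definition posdef (R : realType) (m : nat) (G : 'M[R]_m) : Prop :=
  forall v : 'cV[R]_m, v != 0 -> 0 < (v^T *m G *m v) 0 0.

(* Minimise the objective over all u satisfying every constraint, the
   constraints being indexed by I. *)
Record program (R : realType) (U I : Type) := Program {
  objective : U -> R;
  constraint : I -> set U
}.

Definition compatible (R : realType) (U I : Type) (P : program R U I) : Prop :=
  exists u : U, forall c : I, constraint P c u.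

Definition ecbf_constraint (R : realType) (n m : nat)
    (f : 'cV[R]_n -> 'cV[R]_n) (g : 'cV[R]_n -> 'M[R]_(n, m)) (k : nat)
    (a : 'cV[R]_k) (h : 'cV[R]_n -> R) (x : 'cV[R]_n) : set 'cV[R]_m :=
  [set u | lie_iter f k h x + (lie_mx g (lie_iter f k.-1 h) x *m u) 0 0
           >= - (a^T *m barrier_vector f k h x) 0 0].

(* The 2m constraints: inl i is the one of the lower bound on y_i, inr i that
   of the upper bound. *)
Definition safety_filter (R : realType) (n m : nat)
    (f : 'cV[R]_n -> 'cV[R]_n) (g : 'cV[R]_n -> 'M[R]_(n, m))
    (y : 'cV[R]_n -> 'cV[R]_m) (r : 'I_m -> nat)
    (alpha : forall i, 'cV[R]_(r i)) (ylow yup : 'I_m -> R)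
    (kd : 'cV[R]_n -> 'cV[R]_m) (G : 'cV[R]_n -> 'M[R]_m) (x : 'cV[R]_n) :
    program R 'cV[R]_m ('I_m + 'I_m) :=
  {| objective :=
       fun u => 2^-1 * ((u - kd x)^T *m G x *m (u - kd x)) 0 0;
     constraint := fun c =>
       match c with
       | inl i => ecbf_constraint f g (alpha i) (lower_barrier y ylow i) x
       | inr i => ecbf_constraint f g (alpha i) (upper_barrier y yup i) x
       end |}.

(* Main.v *)
Require Import Defs.
From HB Require Import structures.
From mathcomp Require Import all_boot all_order all_algebra.
From mathcomp Require Import all_classical all_reals all_analysis.
From mathcomp Require Import lra.
Import Order.TTheory GRing.Theory Num.Theory.
Import numFieldNormedType.Exports.
Local Open Scope classical_set_scope.
Local Open Scope ring_scope.

(** Both barriers are [y_i] up to sign and an additive constant. Lie derivatives of positive order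
    kill the constant and commute with the sign, so the constant survives only in the
    undifferentiated entry of the barrier vector, weighted by [alpha_1]. Put [w_i = L_f^{r_i} y_i +
    b_i u + alpha_i^T Y_i], where [Y_i] stacks [y_i] and its Lie derivatives of order below [r_i].
    The two constraints on [y_i] then read [alpha_1 ylow_i <= w_i <= alpha_1 yup_i], a nonempty
    interval. Since the decoupling matrix is invertible, one [u] gives all the [w_i] prescribed
    values; the left endpoints are chosen. [ecbf_constraintD_cst] and the lemmas on negation carry
    the reduction. *)

(** The constant cancels in the difference quotient itself, before any limit is taken. *)
Lemma gradientD_cst (R : realType) (n : nat) (h : 'cV[R]_n -> R) (c : R) :
  gradient (fun x => h x + c) = gradient h.
Proof.
apply/funext => x; apply/rowP => j; rewrite !mxE /derive.
by under eq_fun do rewrite /= opprD addrACA subrr addr0.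
Qed.

(* No differentiability is needed: a divergent limit is 0 by convention. *)
Lemma gradientN (R : realType) (n : nat) (h : 'cV[R]_n -> R) (x : 'cV[R]_n) :
  gradient (fun z => - h z) x = - gradient h x.
Proof.
apply/rowP => j; rewrite !mxE.
have [dh|ndh] := pselect (derivable h x (delta_mx j 0)); first exact: deriveN.
have ndNh : ~ derivable (fun z => - h z) x (delta_mx j 0).
  by move=> /derivableN; rewrite (_ : - _ = h)//; apply/funext => z; exact: opprK.
by rewrite /derive (dvgP ndh) (dvgP ndNh) oppr0.
Qed.

(** The innermost derivative removes the constant; order 0 would keep it. *)
Lemma lie_iterSD_cst (R : realType) (n : nat) (f : 'cV[R]_n -> 'cV[R]_n)
    (h : 'cV[R]_n -> R) (c : R) (j : nat) :
  lie_iter f j.+1 (fun x => h x + c) = lie_iter f j.+1 h.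
Proof. by rewrite /lie_iter !iterSr /lie gradientD_cst. Qed.

Lemma lie_iterN (R : realType) (n : nat) (f : 'cV[R]_n -> 'cV[R]_n)
    (h : 'cV[R]_n -> R) (j : nat) :
  lie_iter f j (fun x => - h x) = fun x => - lie_iter f j h x.
Proof.
elim: j => [//|j IH]; rewrite /lie_iter !iterS -!/(lie_iter f j _) IH.
by apply/funext => x; rewrite /lie gradientN mulNmx mxE.
Qed.

(** Order 0 is included here, because [lie_mx] takes one more gradient. *)
Lemma lie_mxD_cst (R : realType) (n m : nat) (f : 'cV[R]_n -> 'cV[R]_n)
    (g : 'cV[R]_n -> 'M[R]_(n, m)) (h : 'cV[R]_n -> R) (c : R) (j : nat) :
  lie_mx g (lie_iter f j (fun x => h x + c)) = lie_mx g (lie_iter f j h).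
Proof. by case: j => [|j]; rewrite ?lie_iterSD_cst// /lie_mx gradientD_cst. Qed.

(** Only the entry of index 0 contains [h] undifferentiated, so [c] meets only the first gain. *)
Lemma barrier_vectorD_cst (R : realType) (n k : nat)
    (f : 'cV[R]_n -> 'cV[R]_n) (a : 'cV[R]_k) (h : 'cV[R]_n -> R) (c : R)
    (x : 'cV[R]_n) (k_gt0 : (0 < k)%N) :
  (a^T *m barrier_vector f k (fun z => h z + c) x) 0 0 =
  (a^T *m barrier_vector f k h x) 0 0 + a (Ordinal k_gt0) 0 * c.
Proof.
case: k k_gt0 a => // k k_gt0 a.
have -> : Ordinal k_gt0 = ord0 by exact: val_inj.
rewrite !mxE !big_ord_recl !mxE /= mulrDr addrAC; congr (_ + _ + _).
by apply: eq_bigr => j _; rewrite !mxE lift0 lie_iterSD_cst.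
Qed.

Lemma barrier_vectorN (R : realType) (n k : nat)
    (f : 'cV[R]_n -> 'cV[R]_n) (h : 'cV[R]_n -> R) (x : 'cV[R]_n) :
  barrier_vector f k (fun z => - h z) x = - barrier_vector f k h x.
Proof. by apply/colP => j; rewrite !mxE lie_iterN. Qed.

(** Serves both bounds: [y_i] with [c = - ylow i], and [- y_i] with [c = yup i]. *)
Lemma ecbf_constraintD_cst (R : realType) (n m k : nat)
    (f : 'cV[R]_n -> 'cV[R]_n) (g : 'cV[R]_n -> 'M[R]_(n, m)) (a : 'cV[R]_k)
    (h : 'cV[R]_n -> R) (c : R) (x : 'cV[R]_n) (u : 'cV[R]_m)
    (k_gt0 : (0 < k)%N) :
  ecbf_constraint f g a (fun z => h z + c) x u =
  (- ((a^T *m barrier_vector f k h x) 0 0 + a (Ordinal k_gt0) 0 * c) <=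
   lie_iter f k h x + (lie_mx g (lie_iter f k.-1 h) x *m u) 0 0).
Proof.
rewrite /ecbf_constraint /= barrier_vectorD_cst lie_mxD_cst.
by case: k k_gt0 a => // k k_gt0 a; rewrite lie_iterSD_cst.
Qed.

Theorem lemma2 (R : realType) (n m : nat)
    (f : 'cV[R]_n -> 'cV[R]_n) (g : 'cV[R]_n -> 'M[R]_(n, m))
    (y : 'cV[R]_n -> 'cV[R]_m)
    (r : 'I_m -> nat) (r_gt0 : forall i, (0 < r i)%N)
    (N : nat) (r_le_N : forall i, (r i <= N)%N)
    (f_smooth : Ck N f) (g_smooth : Ck N g) (y_smooth : Ck N y)
    (kd : 'cV[R]_n -> 'cV[R]_m)
    (G : 'cV[R]_n -> 'M[R]_m) (G_posdef : forall x, posdef (G x))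
    (ylow yup : 'I_m -> R)
    (alpha : forall i, 'cV[R]_(r i)) (nu : forall i, (r i).-tuple R)
    (alpha_nu : forall i, gains_with_roots (alpha i) (nu i))
    (k : 'cV[R]_n -> 'cV[R]_m)
    (E : set 'cV[R]_n) (E_open : open E)
    (S_sub_E : safe_set f g k y nu ylow yup `<=` E)
    (y_degree : vector_relative_degree_on f g y r E)
    (alpha1_gt0 : forall i, 0 < alpha i (Ordinal (r_gt0 i)) 0)
    (ylow_lt_yup : forall i, ylow i < yup i) :
  forall x : 'cV[R]_n, E x ->
    compatible (safety_filter f g y alpha ylow yup kd G x).
Proof.
move=> x /y_degree[_ _ B_unit].
pose h := output y.
(* The solution for [b_i u] of [w_i = alpha_1 ylow_i]. *)
pose v i := alpha i (Ordinal (r_gt0 i)) 0 * ylow i - lie_iter f (r i) (h i) x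
  - ((alpha i)^T *m barrier_vector f (r i) (h i) x) 0 0.
pose u := invmx (decoupling f g y r x) *m \col_i v i.
have uE i : (lie_mx g (lie_iter f (r i).-1 (h i)) x *m u) 0 0 = v i.
  have : (decoupling f g y r x *m u) i 0 = v i by rewrite mulKVmx// mxE.
  by move=> <-; rewrite !mxE; apply: eq_bigr => j _; rewrite !mxE.
have oppE (A : 'M[R]_1) : (- A) 0 0 = - A 0 0 by rewrite mxE.
(* With B u = v the lower constraints are equalities, and each upper one is
   off by alpha_1 (yup - ylow). *)
exists u => -[] i /=.
- rewrite (@ecbf_constraintD_cst _ _ _ _ _ _ _ (h i) _ _ _ (r_gt0 i)) uE /v.
  by lra.
- rewrite (_ : upper_barrier y yup i = fun z => - h i z + yup i); last first.
    by apply/funext => z; rewrite addrC.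
  rewrite (@ecbf_constraintD_cst _ _ _ _ _ _ _
    (fun z => - h i z) _ _ _ (r_gt0 i)).
  rewrite barrier_vectorN !lie_iterN /lie_mx gradientN !mulNmx mulmxN !oppE.
  rewrite -/(lie_mx g (lie_iter f (r i).-1 (h i)) x) uE /v.
  (* The remaining inequality is [alpha_1 ylow_i <= alpha_1 yup_i]; supplying these products leaves
     a linear goal. *)
  have := ler_wpM2l (ltW (alpha1_gt0 i)) (ltW (ylow_lt_yup i)).
  by lra.
Qed.
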